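(* Let $n\ge 1$. For $F\in\mathsf{For}_n$ we have $\mathsf{T}_F(\mathrm{QSym}_n^+)\subset\mathrm{QSym}_{n-|F|}^+$, and so $\mathsf{T}_F$ descends to a map $$\mathsf{T}_F:\mathrm{QSCoinv}_n\to\mathrm{QSCoinv}_{n-|F|}.$$ In particular, $\mathsf{T}_1,\ldots,\mathsf{T}_{n-1}$ descend to maps $\mathsf{T}_1,\ldots,\mathsf{T}_{n-1}:\mathrm{QSCoinv}_n\to\mathrm{QSCoinv}_{n-1}$.
   Context: $\mathrm{Pol}=\mathbb{Z}[x_1,x_2,\ldots]$, $\mathrm{Pol}_n=\mathbb{Z}[x_1,\ldots,x_n]$. $\mathrm{QSym}_n\subset \mathrm{Pol}_n$ is the ring of polynomials such that for every sequence $a_1,\ldots,a_k\ge 1$ the coefficients of $x_{i_1}^{a_1}\cdots x_{i_k}^{a_k}$ and $x_{j_1}^{a_1}\cdots x_{j_k}^{a_k}$ are equal whenever $1\le i_1<\cdots<i_k\le n$ and $1\le j_1<\cdots<j_k\le n$. $\mathrm{QSym}_n^+$ is the ideal of $\mathrm{Pol}_n$ generated by all $f\in\mathrm{QSym}_n$ with zero constant term, and $\mathrm{QSCoinv}_n=\mathrm{Pol}_n/\mathrm{QSym}_n^+$. For $i\ge 1$, $\mathsf{R}_i(f)=f(x_1,\ldots,x_{i-1},0,x_i,x_{i+1},\ldots)$ and $\mathsf{T}_i(f)=\frac{\mathsf{R}_{i+1}(f)-\mathsf{R}_i(f)}{x_i}$ for $f\in\mathrm{Pol}$. Forests: a binary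 tree is a finite rooted plane tree in which each node is either a leaf (no children) or internal, having an ordered pair of children; $\ast$ is the tree with a single node (a leaf). An indexed forest is an infinite sequence $F=(T_1,T_2,\ldots)$ of binary trees, all but finitely many equal to $\ast$; $\mathsf{For}$ is the set of indexed forests, and $\varnothing$ is the forest all of whose trees are $\ast$. The leaves of $F$, read from left to right, are identified with $1,2,3,\ldots$. $|F|$ is the number of internal nodes of $F$. $\mathrm{supp}(F)\subset\mathbb{N}$ is the set of leaves of the trees of $F$ different from $\ast$, and $\mathsf{For}_n=\{F\in\mathsf{For}:\mathrm{supp}(F)\subset\{1,\ldots,n\}\}$. The product $F\cdot G$ is obtained by identifying, for each $i$, the $i$-th leaf of $F$ with the root of the $i$-th tree of $G$; this is a monoid structure with identity $\varnothing$. $\underline{i}$ is the forest whose only nontrivial tree is its $i$-th tree, which has exactly one internal node; these generate $\mathsf{For}$. For $F\in\mathsf{For}$, $\mathsf{T}_F=\mathsf{T}_{i_1}\cdots\mathsf{T}_{i_k}$ (composition) for any expression $F=\underline{i_1}\cdots\underline{i_k}$; this is independent of the expression, and $\mathsf{T}_\varnothing=\mathrm{id}$. *)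

(* Defs.v *)
From HB Require Import structures.
From mathcomp Require Import all_boot all_order all_algebra.
From mathcomp Require Import finmap boolp.
From mathcomp Require Import monalg zify.

Set Implicit Arguments.
Unset Strict Implicit.
Unset Printing Implicit Defensive.

Import GRing.Theory.
Local Open Scope fset_scope.
Local Open Scope ring_scope.

(* Indices are shifted by one throughout: everything the literature numbers
   1, 2, 3, ... (variables, trees, leaves, the operators R_i and T_i) is
   numbered 0, 1, 2, ... here. *)

(** * Polynomials in countably many variables *)

Notation Pol := {malg int[{cmonom nat}]}.

HB.lock Definition Xvar (i : nat) : Pol := << ucm i >>.

Definition mon_subst (s : nat -> Pol) (m : {cmonom nat}) : Pol :=
  \prod_(i <- finsupp m) s i ^+ m i.

Lemma mon_substEw s (d : {fset nat}) (m : {cmonom nat}) :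
  finsupp m `<=` d -> mon_subst s m = \prod_(i <- d) s i ^+ m i.
Proof.
move=> le; rewrite /mon_subst; apply: big_fset_incl => // i _ Hi.
by move: Hi; rewrite -cmE_eq0 => /eqP->.
Qed.

Lemma mon_subst_is_mult s : mmorphism (mon_subst s).
Proof.
split=> [m1 m2|]; last by rewrite /mon_subst mdom1 big_seq_fset0.
rewrite (@mon_substEw s (finsupp m1 `|` finsupp m2)%fset (mmul m1 m2)) ?mdomD //.
rewrite (@mon_substEw s (finsupp m1 `|` finsupp m2)%fset m1) ?fsubsetUl //.
rewrite (@mon_substEw s (finsupp m1 `|` finsupp m2)%fset m2) ?fsubsetUr //.
by rewrite -big_split /=; apply: eq_bigr => i _; rewrite cmM exprD.
Qed.

HB.instance Definition _ s :=
  isMultiplicative.Build {cmonom nat} Pol (mon_subst s) (mon_subst_is_mult s).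

(* f(s 0, s 1, s 2, ...) *)
HB.lock Definition psubst (s : nat -> Pol) (f : Pol) : Pol :=
  mmap (@malgC {cmonom nat} int) (mon_subst s) f.

Lemma psubst_is_zmod_morphism s : zmod_morphism (psubst s).
Proof. by rewrite unlock => f g; exact: raddfB. Qed.

Lemma psubst_is_monoid_morphism s : monoid_morphism (psubst s).
Proof.
rewrite unlock; split; first exact: mmap1.
exact: (mmap_is_multiplicative (f := @malgC {cmonom nat} int)
  (h := mon_subst s)).1.
Qed.

HB.instance Definition _ s :=
  GRing.isZmodMorphism.Build Pol Pol (psubst s) (psubst_is_zmod_morphism s).
HB.instance Definition _ s :=
  GRing.isMonoidMorphism.Build Pol Pol (psubst s) (psubst_is_monoid_morphism s).

Lemma psubstX s i : psubst s (Xvar i) = s i.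
Proof.
rewrite !unlock mmapU /= mpolyC1E mul1r /mon_subst mdomU big_seq_fset1.
by rewrite cmUU expr1.
Qed.

Lemma psubstE s f :
  psubst s f = \sum_(m <- msupp f) malgC f@_m * mon_subst s m.
Proof. by rewrite unlock; exact: mmapE. Qed.

Lemma psubstC s c : psubst s (malgC c) = malgC c.
Proof. by rewrite unlock mmapC. Qed.

Lemma psubst_comp s t f :
  psubst s (psubst t f) = psubst (fun i => psubst s (t i)) f.
Proof.
rewrite (psubstE t f) (psubstE _ f) raddf_sum; apply: eq_bigr => m _.
rewrite [LHS]rmorphM; congr (_ * _); first exact: psubstC.
rewrite /mon_subst rmorph_prod; apply: eq_bigr => i _.
exact: rmorphXn.
Qed.

Lemma eq_psubst s t : s =1 t -> psubst s =1 psubst t.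
Proof.
move=> e f; rewrite (psubstE s) (psubstE t).
have E m : mon_subst s m = mon_subst t m by apply: eq_bigr => i _; rewrite e.
apply: eq_bigr => m _. rewrite (E m). reflexivity.
Qed.

Definition Rsub (i j : nat) : Pol :=
  if (j < i)%N then Xvar j else if j == i then 0 else Xvar j.-1.

Definition Rop (i : nat) : Pol -> Pol := psubst (Rsub i).

HB.instance Definition _ i := GRing.RMorphism.copy (Rop i) (psubst (Rsub i)).

(* Exact quotient of f by Xvar i: monomials not divisible by Xvar i are dropped. *)
HB.lock Definition divX (i : nat) (f : Pol) : Pol :=
  \sum_(m <- msupp f | (0 < m i)%N) << f@_m *g divcm m (ucm i) >>.

HB.lock Definition Top (i : nat) (f : Pol) : Pol := divX i (Rop i.+1 f - Rop i f).

Lemma mcoeff_divX i f m : (divX i f)@_m = f@_(mmul (ucm i) m).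
Proof.
rewrite unlock raddf_sum /=.
have e (m' : {cmonom nat}) : (0 < m' i)%N ->
   (divcm m' (ucm i) == m) = (m' == mmul (ucm i) m).
  move=> h; apply/cmP/cmP => [H j|H j].
    rewrite cmM -H divcmE cmU; case: eqP => [<-|_]; last by rewrite add0n subn0.
    by rewrite addnC subnK.
  by rewrite divcmE H cmM addKn.
under eq_bigr => m' h do rewrite mcoeffU e //.
case: (boolP (mmul (ucm i) m \in msupp f)) => h; last first.
  rewrite (mcoeff_outdom h) big1_seq // => m' /andP[_ hm']; case: eqP => // E.
  by move: h; rewrite -E hm'.
rewrite (big_rem _ h) /= cmM cmUU /= eqxx mulr1n big1_seq ?addr0 //.
move=> m' /andP[_]; rewrite mem_rem_uniq ?fset_uniq // inE => /andP[/negPf-> _].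
by [].
Qed.

Lemma mcoeffXM i g m : (Xvar i * g)@_(mmul (ucm i) m) = g@_m.
Proof.
rewrite unlock malgME msuppU1 big_seq_fset1 raddf_sum /=.
have e (m' : {cmonom nat}) :
    (mmul (ucm i) m' == mmul (ucm i) m) = (m' == m).
  apply/eqP/eqP => [H|-> //]; apply/eqP/cmP => j.
  by have := congr1 (fun z : {cmonom nat} => z j) H; rewrite !cmM => /addnI.
have U : (<<ucm i>> : Pol)@_(ucm i) = 1 by rewrite mcoeffU1 eqxx.
rewrite U.
transitivity (\sum_(m' <- msupp g) g@_m' *+ (m' == m)).
  apply: eq_bigr => m' _; rewrite mul1r.
  by rewrite -(e m'); exact: mcoeffU.
case: (boolP (m \in msupp g)) => h; last first.
  rewrite (mcoeff_outdom h) big1_seq // => m' /andP[_ hm']; case: eqP => // E.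
  by move: h; rewrite -E hm'.
rewrite (big_rem _ h) /= eqxx mulr1n big1_seq ?addr0 //.
move=> m' /andP[_]; rewrite mem_rem_uniq ?fset_uniq // inE => /andP[/negPf-> _].
by [].
Qed.

Lemma divXK i g : divX i (Xvar i * g) = g.
Proof. by apply/malgP => m; rewrite mcoeff_divX mcoeffXM. Qed.

Lemma X_inj i (f g : Pol) : Xvar i * f = Xvar i * g -> f = g.
Proof. by move=> H; rewrite -(divXK i f) H divXK. Qed.

Lemma psubst_congr i s t f :
    (forall j, exists g, s j - t j = Xvar i * g) ->
  exists g, psubst s f - psubst t f = Xvar i * g.
Proof.
move=> H; pose D (p : Pol) := exists g, p = Xvar i * g.
have D0 : D 0 by exists 0; rewrite mulr0.
have DD p q : D p -> D q -> D (p + q).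
  by move=> [a ->] [b ->]; exists (a + b); rewrite mulrDr.
have DM p q : D q -> D (p * q).
  by move=> [a ->]; exists (p * a); rewrite mulrCA.
rewrite -/(D _) (psubstE s) (psubstE t) -sumrB.
apply: big_ind => // m _; rewrite -mulrBr; apply: (DM).
rewrite /mon_subst.
apply: (big_ind2 (fun p q => D (p - q))) => //.
- by rewrite subrr.
- move=> a b c d h1 h2.
  have -> : a * c - b * d = c * (a - b) + b * (c - d).
    by rewrite !mulrBr addrA [b * c]mulrC subrK [c * a]mulrC.
  by apply: (DD); apply: (DM).
- by move=> j _; rewrite subrXX mulrC; apply: (DM).
Qed.

Lemma T_spec i f : Xvar i * Top i f = Rop i.+1 f - Rop i f.
Proof.
rewrite [Top]unlock; suff [g ->] : exists g, Rop i.+1 f - Rop i f = Xvar i * g by rewrite divXK.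
apply: psubst_congr => j; rewrite /Rsub; case: (ltngtP j i) => [h|h|->].
- by rewrite ltnW //; exists 0; rewrite subrr mulr0.
- rewrite ltnNge h /=; case: eqP => [->|_].
    by exists (-1); rewrite /= mulrN1 sub0r.
  by exists 0; rewrite subrr mulr0.
- by rewrite ltnSn; exists 1; rewrite mulr1 subr0.
Qed.

Lemma RX_lt i j : (j < i)%N -> Rop i (Xvar j) = Xvar j.
Proof. by move=> h; rewrite /Rop psubstX /Rsub h. Qed.

Lemma RX_eq i : Rop i (Xvar i) = 0.
Proof. by rewrite /Rop psubstX /Rsub ltnn eqxx. Qed.

Lemma RX_gt i j : (i <= j)%N -> Rop i (Xvar j.+1) = Xvar j.
Proof. by move=> h; rewrite /Rop psubstX /Rsub ltnNge leqW //= gtn_eqF. Qed.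

Lemma R_comm i j f : (i <= j)%N -> Rop j (Rop i f) = Rop i (Rop j.+1 f).
Proof.
move=> le.
rewrite [LHS](psubst_comp (Rsub j) (Rsub i)) [RHS](psubst_comp (Rsub i) (Rsub j.+1)).
apply: eq_psubst => k; rewrite -/(Rop i _) -/(Rop j _).
rewrite [Rsub i k]/Rsub [Rsub j.+1 k]/Rsub.
case: (ltngtP k i) => h.
- by rewrite ltnS (ltnW (leq_trans h le)) !RX_lt // (leq_trans h le).
- have kE : k = k.-1.+1 by rewrite (ltn_predK h).
  move: k.-1 kE h => {}k -> h; rewrite !ltnS eqSS.
  case: (ltngtP k j) => h'.
  + by rewrite RX_lt // RX_gt.
  + have kE : k = k.-1.+1 by rewrite (ltn_predK h').
    move: k.-1 kE h h' => {}k -> h h'.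
    by rewrite (RX_gt (h' : j <= k)%N) (RX_gt (leq_trans le h')).
  + by rewrite h' RX_eq; symmetry; exact: (raddf0 (Rop i)).
- by rewrite h ltnS le RX_eq; exact: (raddf0 (Rop j)).
Qed.

Lemma T_comm i k f : (i < k)%N -> Top k (Top i f) = Top i (Top k.+1 f).
Proof.
move=> h; apply: (@X_inj k); apply: (@X_inj i).
have le : (i <= k)%N := ltnW h.
have E1 : Xvar i * (Xvar k * Top k (Top i f)) =
    Rop k.+1 (Rop i.+1 f - Rop i f) - Rop k (Rop i.+1 f - Rop i f).
  have M1 : Rop k.+1 (Xvar i * Top i f) = Rop k.+1 (Xvar i) * Rop k.+1 (Top i f) by exact: rmorphM.
  have M2 : Rop k (Xvar i * Top i f) = Rop k (Xvar i) * Rop k (Top i f) by exact: rmorphM.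
  rewrite (T_spec i f) (RX_lt (leqW h : i < k.+1)%N) in M1.
  rewrite (T_spec i f) (RX_lt h) in M2.
  have := T_spec k (Top i f); move: M1 M2.
  move: (Rop k.+1 _) (Rop k _) (Rop k.+1 _) (Rop k _) (Top k _) (Xvar i) (Xvar k).
  by move=> a b c d e u v -> -> ->; rewrite mulrBr.
have E2 : Xvar k * (Xvar i * Top i (Top k.+1 f)) =
    Rop i.+1 (Rop k.+2 f - Rop k.+1 f) - Rop i (Rop k.+2 f - Rop k.+1 f).
  have M1 : Rop i.+1 (Xvar k.+1 * Top k.+1 f) = Rop i.+1 (Xvar k.+1) * Rop i.+1 (Top k.+1 f) by exact: rmorphM.
  have M2 : Rop i (Xvar k.+1 * Top k.+1 f) = Rop i (Xvar k.+1) * Rop i (Top k.+1 f) by exact: rmorphM.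
  rewrite (T_spec k.+1 f) (RX_gt h) in M1.
  rewrite (T_spec k.+1 f) (RX_gt le) in M2.
  have := T_spec i (Top k.+1 f); move: M1 M2.
  move: (Rop i.+1 _) (Rop i _) (Rop i.+1 _) (Rop i _) (Top i _) (Xvar i) (Xvar k).
  by move=> a b c d e u v -> -> ->; rewrite mulrBr.
have E3 : Rop k.+1 (Rop i.+1 f - Rop i f) - Rop k (Rop i.+1 f - Rop i f) =
    Rop i.+1 (Rop k.+2 f - Rop k.+1 f) - Rop i (Rop k.+2 f - Rop k.+1 f).
  have B a p q : Rop a (p - q) = Rop a p - Rop a q by exact: rmorphB.
  rewrite (B k.+1 (Rop i.+1 f) (Rop i f)) (B k (Rop i.+1 f) (Rop i f)).
  rewrite (B i.+1 (Rop k.+2 f) (Rop k.+1 f)) (B i (Rop k.+2 f) (Rop k.+1 f)).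
  rewrite (R_comm f (ltnW h : i.+1 <= k.+1)%N) (R_comm f (leqW le)).
  rewrite (R_comm f h) (R_comm f le).
  move: (Rop i.+1 _) (Rop i _) (Rop i.+1 _) (Rop i _) => a b c d.
  by rewrite !opprB addrACA [RHS]addrACA; congr (_ + _); rewrite addrC.
apply: etrans E1 (etrans E3 (etrans (esym E2) _)).
by move: (Xvar i) (Xvar k) (Top i _) => a b c; rewrite mulrCA.
Qed.

(** * Indexed forests *)

Inductive btree : Type := Leaf | Node of btree & btree.

Fixpoint btree_encode (t : btree) : GenTree.tree unit :=
  if t is Node l r then GenTree.Node 0 [:: btree_encode l; btree_encode r]
  else GenTree.Leaf tt.

Fixpoint btree_decode (u : GenTree.tree unit) : option btree :=
  match u with
  | GenTree.Leaf _ => Some Leaf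
  | GenTree.Node _ [:: u1; u2] =>
      if (btree_decode u1, btree_decode u2) is (Some l, Some r)
      then Some (Node l r) else None
  | _ => None
  end.

Lemma btree_encodeK : pcancel btree_encode btree_decode.
Proof. by elim=> //= l -> r ->. Qed.

HB.instance Definition _ := Countable.copy btree (pcan_type btree_encodeK).

Fixpoint nleaves (t : btree) : nat :=
  if t is Node l r then (nleaves l + nleaves r)%N else 1%N.

Fixpoint ninternal (t : btree) : nat :=
  if t is Node l r then (ninternal l + ninternal r).+1 else 0%N.

Notation forest := {fsfun nat -> btree with Leaf}.

Definition fempty : forest := [fsfun].

(* Index of the leftmost leaf of the i-th tree. *)
Definition offset (F : nat -> btree) (i : nat) : nat :=
  (\sum_(k < i) nleaves (F k))%N.

Definition fsize (F : forest) : nat := (\sum_(i <- finsupp F) ninternal (F i))%N.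

Definition fsupp (F : forest) (p : nat) : Prop :=
  exists i, F i != Leaf /\ (offset F i <= p < offset F i.+1)%N.

Definition For (n : nat) (F : forest) : Prop :=
  forall p, fsupp F p -> (p < n)%N.

(* The k-th leaf of t is replaced by g k. *)
Fixpoint graft (t : btree) (g : nat -> btree) : btree :=
  if t is Node l r
  then Node (graft l g) (graft r (fun k => g (nleaves l + k)%N))
  else g 0%N.

(* All trees of F beyond this index are trivial. *)
Definition fbound (F : forest) : nat := (\max_(i <- finsupp F) i.+1)%N.

Definition fmul_tree (F G : nat -> btree) (i : nat) : btree :=
  graft (F i) (fun k => G (offset F i + k)%N).

Definition fmul (F G : forest) : forest :=
  [fsfun i in [fset i | i in iota 0 (maxn (fbound F) (fbound G))]
     => fmul_tree F G i].

Definition fgen (i : nat) : forest := [fsfun _ in [fset i] => Node Leaf Leaf].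

Definition fprod (w : seq nat) : forest := foldr (fun i => fmul (fgen i)) fempty w.

Lemma fboundP (F : forest) i : (fbound F <= i)%N -> F i = Leaf.
Proof.
move=> le; case: (finsuppP F i) => // h.
have : (i.+1 <= fbound F)%N by rewrite /fbound (big_rem _ h) /= leq_maxl.
by rewrite leqNgt ltnS le.
Qed.

Lemma fbound_le (F : forest) N :
  (forall i, (N <= i)%N -> F i = Leaf) -> (fbound F <= N)%N.
Proof.
move=> H; rewrite /fbound; apply/bigmax_leqP_seq => i h _.
by rewrite ltnNge; apply/negP => /H E; move: h; rewrite mem_finsupp E.
Qed.

Lemma nleaves_gt0 t : (0 < nleaves t)%N.
Proof. by elim: t => //= l hl r hr; rewrite addn_gt0 hl. Qed.

Lemma nleavesE t : nleaves t = (ninternal t).+1.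
Proof. by elim: t => //= l -> r ->; rewrite addSn addnS. Qed.

Lemma offsetS F i : offset F i.+1 = (offset F i + nleaves (F i))%N.
Proof. by rewrite /offset big_ord_recr. Qed.

Lemma offset_ge F i : (i <= offset F i)%N.
Proof.
elim: i => // i IH; rewrite offsetS -addn1 leq_add //; exact: nleaves_gt0.
Qed.

Lemma eq_graft t g h : g =1 h -> graft t g = graft t h.
Proof. by elim: t g h => [|l IHl r IHr] g h e /=; rewrite ?(IHl _ h) ?(IHr _ (fun k => h (nleaves l + k)%N)) // => k; rewrite e. Qed.

Lemma graft_Leaf t : graft t (fun=> Leaf) = t.
Proof. by elim: t => //= l -> r ->. Qed.

Lemma fmulE (F G : forest) i : fmul F G i = fmul_tree F G i.
Proof.
rewrite fsfunE; case: ifPn => //.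
rewrite inE /= mem_iota leq0n add0n -leqNgt geq_max => /andP[hF hG].
rewrite /fmul_tree (fboundP hF) /= addn0 fboundP //.
exact: leq_trans hG (offset_ge F i).
Qed.

Lemma fgenE i j : fgen i j = if j == i then Node Leaf Leaf else Leaf.
Proof. by rewrite fsfunE inE. Qed.

Lemma fmul1f F : fmul fempty F = F.
Proof.
apply/fsfunP => i; rewrite fmulE /fmul_tree fsfun0E /= addn0; congr (F _).
elim: i => [|i IH]; first by rewrite /offset big_ord0.
by rewrite offsetS fsfun0E IH addn1.
Qed.

Lemma fmulf1 F : fmul F fempty = F.
Proof.
apply/fsfunP => i; rewrite fmulE /fmul_tree.
by rewrite (@eq_graft _ _ (fun=> Leaf)) ?graft_Leaf // => k; rewrite fsfun0E.
Qed.

Definition merge_at (i : nat) (g : nat -> btree) (j : nat) : btree :=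
  if (j < i)%N then g j else if j == i then Node (g i) (g i.+1) else g j.+1.

Lemma offset_fgen i j : offset (fgen i) j = if (j <= i)%N then j else j.+1.
Proof.
elim: j => [|j IH]; first by rewrite /offset big_ord0.
rewrite offsetS IH fgenE; case: (ltngtP j i) => h /=; rewrite ?addn1 //.
by rewrite addn2.
Qed.

Lemma fmul_fgen i (F : forest) j : fmul (fgen i) F j = merge_at i F j.
Proof.
rewrite fmulE /fmul_tree fgenE offset_fgen /merge_at.
case: (ltngtP j i) => h /=; rewrite ?addn0 //.
by rewrite h addn1.
Qed.

(* One root at a time, from the rightmost tree to the leftmost one, and in each
   tree in preorder with the right subtree first. *)
Fixpoint tword (i : nat) (t : btree) : seq nat :=
  if t is Node l r then i :: tword i.+1 r ++ tword i l else [::].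

Fixpoint gword (g : nat -> btree) (N : nat) : seq nat :=
  if N is M.+1 then tword M (g M) ++ gword g M else [::].

Definition fword (F : forest) : seq nat := gword F (fbound F).

Lemma eq_merge_at i g h : g =1 h -> merge_at i g =1 merge_at i h.
Proof. by move=> e j; rewrite /merge_at !e. Qed.

Definition wact (w : seq nat) (g : nat -> btree) : nat -> btree :=
  foldr merge_at g w.

Lemma eq_wact w g h : g =1 h -> wact w g =1 wact w h.
Proof. by move=> e; elim: w => //= i w IH; apply: eq_merge_at. Qed.

Lemma fprodE w : fprod w =1 wact w (fun=> Leaf).
Proof.
elim: w => [|i w IH] j /=; first by rewrite fsfun0E.
by rewrite fmul_fgen; apply: eq_merge_at.
Qed.

Lemma wact_tword t i g : wact (tword i t) g =1 fun j =>
  if (j < i)%N then g j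
  else if j == i then graft t (fun k => g (i + k)%N)
  else g (j + nleaves t).-1%N.
Proof.
elim: t i g => [|l IHl r IHr] i g j /=.
  by case: (ltngtP j i) => // h; rewrite ?addn1 //= ?addn0 h.
have nl := nleaves_gt0 l; have nr := nleaves_gt0 r.
rewrite /wact foldr_cat -!/(wact _ _).
set g1 := wact (tword i l) g.
rewrite /merge_at !IHr ltnSn ltnn eqxx.
have g1E k : g1 k = if (k < i)%N then g k
  else if k == i then graft l (fun k => g (i + k)%N)
  else g (k + nleaves l).-1%N by exact: IHl.
have [h|[->|h]] : (j < i \/ j = i \/ i < j)%N by lia.
- have -> : (j < i.+1)%N by lia.
  by rewrite h g1E h.
- rewrite !ltnn !eqxx ?ltnSn g1E !ltnn !eqxx; congr (Node _ _); apply: eq_graft => k.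
  rewrite g1E; have -> : (i.+1 + k + nleaves l).-1%N = (i + (nleaves l + k))%N by lia.
  have -> : (i.+1 + k < i)%N = false by lia.
  by have -> : (i.+1 + k == i)%N = false by lia.
- have -> : (j < i)%N = false by lia.
  have -> : (j == i)%N = false by lia.
  have -> : (j.+1 < i.+1)%N = false by lia.
  have -> : (j.+1 == i.+1)%N = false by lia.
  rewrite g1E.
  have -> : ((j.+1 + nleaves r).-1 < i)%N = false by lia.
  have -> : ((j.+1 + nleaves r).-1 == i)%N = false by lia.
  by congr (g _); lia.
Qed.

Lemma wact_gword g N : wact (gword g N) (fun=> Leaf) =1
  fun j => if (j < N)%N then g j else Leaf.
Proof.
elim: N => [|N IH] j //=.
rewrite /wact foldr_cat -!/(wact _ _) wact_tword !IH ltnS.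
have := nleaves_gt0 (g N) => n0.
case: (ltngtP j N) => h; last first.
- rewrite h (@eq_graft _ _ (fun=> Leaf)) ?graft_Leaf // => k.
  by rewrite IH ltnNge leq_addr.
- by rewrite ltnNge (_ : N <= _)%N //; lia.
- by [].
Qed.

Lemma fwordK F : fprod (fword F) = F.
Proof.
apply/fsfunP => i; rewrite fprodE wact_gword.
by case: ltnP => // /fboundP.
Qed.

(* So n - |F| is never truncated when F is in For n. *)
Lemma leq_fsize n F : For n F -> (fsize F <= n)%N.
Proof.
move=> hF.
have off N : offset F N = (N + \sum_(k < N) ninternal (F k))%N.
  elim: N => [|N IH]; first by rewrite /offset !big_ord0.
  by rewrite offsetS IH big_ord_recr /= nleavesE; lia.
have szE : fsize F = (\sum_(k < fbound F) ninternal (F k))%N.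
  rewrite /fsize -(big_mkord xpredT (fun k => ninternal (F k))).
  rewrite [RHS](bigID (fun k => k \in finsupp F)) /= [X in _ = (_ + X)%N]big1 ?addn0.
    rewrite -[RHS]big_filter; apply: perm_big; apply: uniq_perm.
    - exact: fset_uniq.
    - by rewrite filter_uniq // iota_uniq.
    move=> k; rewrite mem_filter mem_index_iota /=; case: (boolP (k \in _)) => //= h.
    by rewrite ltnNge; apply/esym/negP => /fboundP E; move: h; rewrite mem_finsupp E.
  by move=> k /fsfun_dflt->.
case: (posnP (fbound F)) => [b0|b0]; first by rewrite szE b0 big_ord0.
have hN : F (fbound F).-1 != Leaf.
  apply/eqP => E; suff : (fbound F <= (fbound F).-1)%N by lia.
  apply: fbound_le => i; rewrite leq_eqVlt => /orP[/eqP<- //|h].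
  by apply: fboundP; lia.
have := off (fbound F); rewrite -szE => E.
have hp := nleaves_gt0 (F (fbound F).-1).
suff : (offset F (fbound F) <= n)%N by lia.
have := hF (offset F (fbound F)).-1.
have E2 : offset F (fbound F) =
    (offset F (fbound F).-1 + nleaves (F (fbound F).-1))%N.
  by rewrite -offsetS prednK.
move=> H; have {H} : ((offset F (fbound F)).-1 < n)%N.
  by apply: H; exists (fbound F).-1; split=> //; rewrite (prednK b0); apply/andP; split; lia.
by lia.
Qed.

(** * The operators T_F *)

Definition Tword (w : seq nat) (f : Pol) : Pol := foldr Top f w.

Definition TF (F : forest) : Pol -> Pol := Tword (fword F).

Lemma Tword_cat w1 w2 f : Tword (w1 ++ w2) f = Tword w1 (Tword w2 f).
Proof. exact: foldr_cat. Qed.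

Lemma Tword_node k l r f : Tword (tword k (Node l r)) f =
  Top k (Tword (tword k.+1 r) (Tword (tword k l) f)).
Proof. by rewrite -Tword_cat. Qed.

Lemma Tword_tword i k t f : (i < k)%N ->
  Tword (tword k t) (Top i f) = Top i (Tword (tword k.+1 t) f).
Proof.
elim: t k f => [|l IHl r IHr] k f h; first by [].
have E1 := IHl k f h.
have E2 := IHr k.+1 (Tword (tword k.+1 l) f) (leqW h).
have E3 := T_comm (Tword (tword k.+2 r) (Tword (tword k.+1 l) f)) h.
by rewrite Tword_node E1 E2 E3 (Tword_node k.+1).
Qed.

Lemma gword_merge_low i g N : (N <= i)%N -> gword (merge_at i g) N = gword g N.
Proof.
elim: N => // N IH le; rewrite /gword -/gword IH 1?ltnW //.
by rewrite /merge_at le.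
Qed.

Lemma Tword_merge i g N f : (i < N)%N ->
  Tword (gword (merge_at i g) N) f = Top i (Tword (gword g N.+1) f).
Proof.
elim: N => // N IH; rewrite ltnS leq_eqVlt => /orP[/eqP<-|h].
  rewrite /gword -/gword !Tword_cat {1}/merge_at ltnn eqxx.
  by rewrite (gword_merge_low g (leqnn i)) Tword_node.
have -> : gword (merge_at i g) N.+1 = tword N (g N.+1) ++ gword (merge_at i g) N.
  by rewrite /= {1}/merge_at ltnNge ltnW //= gtn_eqF.
by rewrite Tword_cat IH // Tword_tword // -Tword_cat.
Qed.

Lemma eq_gword g h N : g =1 h -> gword g N = gword h N.
Proof. by move=> e; elim: N => //= N ->; rewrite e. Qed.

Lemma gword_fword (F : forest) N : (fbound F <= N)%N -> gword F N = fword F.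
Proof.
move=> /subnK<-; elim: (N - _)%N => // k IH.
by rewrite addSn /= IH fboundP // leq_addl.
Qed.

(* T_F can be computed from any factorisation of F. *)
Lemma TF_fprod w f : TF (fprod w) f = Tword w f.
Proof.
elim: w => [|i w IH].
  by rewrite /TF /fword (_ : fbound _ = 0%N) // /fbound finsupp0 big_seq_fset0.
have -> : Tword (i :: w) f = Top i (Tword w f) by [].
rewrite -IH /TF.
set F := fprod w; have -> : fprod (i :: w) = fmul (fgen i) F by [].
set N := maxn i.+1 (maxn (fbound (fmul (fgen i) F)) (fbound F)).
rewrite -(@gword_fword (fmul (fgen i) F) N) ?leq_max ?leqnn ?orbT //.
rewrite -(@gword_fword F N.+1); last by rewrite leqW // !leq_max leqnn !orbT.
rewrite (eq_gword _ (fmul_fgen i F)) Tword_merge //.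
by rewrite leq_max leqnn.
Qed.

(** * Quasisymmetric coinvariants *)

(* Z[x_0, ..., x_(n-1)], inside Pol. *)
Definition in_Pol (n : nat) : {pred Pol} :=
  fun f => all (fun m : {cmonom nat} => all (fun i => (i < n)%N) (finsupp m))
             (msupp f).

Lemma in_PolP n f : reflect
  (forall (m : {cmonom nat}) i, f@_m != 0 -> m i != 0%N -> (i < n)%N)
  (f \in in_Pol n).
Proof.
apply: (iffP allP) => [H m i fm mi|H m fm].
  have fm' : m \in msupp f by rewrite -mcoeff_neq0.
  by have /allP h := H m fm'; apply: h; rewrite mem_finsupp.
by apply/allP => i; rewrite mem_finsupp => mi; apply: H mi; rewrite mcoeff_neq0.
Qed.

Lemma in_Pol_subring n : subring_closed (in_Pol n).
Proof.
split=> [|f g /in_PolP hf /in_PolP hg|f g /in_PolP hf /in_PolP hg].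
- apply/in_PolP => m i; rewrite mcoeff1; case: (eqVneq m (@mone _)) => [->|_].
    by rewrite cm1.
  by rewrite eqxx.
- apply/in_PolP => m i; rewrite mcoeffB => fg mi.
  case: (eqVneq f@_m 0) => [f0|h]; last exact: hf h mi.
  by apply: hg mi; move: fg; rewrite f0 sub0r oppr_eq0.
- apply/in_PolP => m i; rewrite mcoeff_neq0 => /msuppM_le[k1 [k2 [h1 h2 ->]]].
  rewrite cmM addn_eq0 negb_and => /orP[h|h].
    by apply: hf h; rewrite mcoeff_neq0.
  by apply: hg h; rewrite mcoeff_neq0.
Qed.

HB.instance Definition _ n :=
  GRing.isSubringClosed.Build Pol (in_Pol n) (in_Pol_subring n).

Record PolN (n : nat) := MkPolN { pol_of :> Pol; _ : pol_of \in in_Pol n }.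

HB.instance Definition _ n := [isSub for @pol_of n].
HB.instance Definition _ n := [Choice of PolN n by <:].
HB.instance Definition _ n := [SubChoice_isSubComNzRing of PolN n by <:].

(* x_(i 0)^(a 0) * ... * x_(i (k-1))^(a (k-1)) *)
Definition monom_at (k : nat) (i a : 'I_k -> nat) : {cmonom nat} :=
  \big[@mmul _/@mone _]_(s < k) expcmn (ucm (i s)) (a s).

Definition QSym (n : nat) (f : Pol) : Prop :=
  f \in in_Pol n /\
  forall (k : nat) (a : 'I_k -> nat) (i j : 'I_k -> 'I_n),
    (forall s, (0 < a s)%N) ->
    {homo i : s t / (s < t)%N} -> {homo j : s t / (s < t)%N} ->
    f@_(monom_at i a) = f@_(monom_at j a).

Definition QSymPlus (n : nat) (f : Pol) : Prop :=
  exists2 s : seq (Pol * Pol),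
    {in s, forall u, [/\ u.1 \in in_Pol n, QSym n u.2 & u.2@_(@mone _) = 0]} &
    f = \sum_(u <- s) u.1 * u.2.

Lemma QSymPlus_mulD n (a f g : Pol) : a \in in_Pol n ->
  QSymPlus n f -> QSymPlus n g -> QSymPlus n (a * f + g).
Proof.
move=> ha [s hs fE] [t ht gE].
exists ([seq (a * u.1, u.2) | u <- s] ++ t).
  move=> u; rewrite mem_cat => /orP[/mapP[v /hs[v1 v2 v0] E]|]; last exact: ht.
  by rewrite E; split; rewrite ?rpredM.
rewrite big_cat big_map; apply: (f_equal2 +%R); last exact: gE.
rewrite fE mulr_sumr; apply: eq_bigr => u _; exact: (mulrA a u.1 u.2).
Qed.

Definition QSymPlus_ideal (n : nat) : {pred PolN n} :=
  fun f => `[< QSymPlus n (val f) >].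

Lemma QSymPlus_idealr n : idealr_closed (@QSymPlus_ideal n).
Proof.
split.
- by apply/asboolP; exists [::]; rewrite // big_nil.
- apply/negP => /asboolP[s hs] /(congr1 (mcoeff (@mone _))).
  rewrite (raddf_sum (mcoeff (@mone _))) big1_seq => [|u /andP[_ /hs[_ _ u0]]].
    by rewrite /= mcoeff1 eqxx.
  apply: etrans ((mcoeff1g_is_multiplicative {cmonom nat} int).1 u.1 u.2) _.
  by rewrite u0 mulr0.
- move=> a f g /asboolP hf /asboolP hg; apply/asboolP.
  have -> : val (a * f + g) = val a * val f + val g.
    by apply: etrans (rmorphD (val : PolN n -> Pol) _ _) _; rewrite rmorphM.
  apply: QSymPlus_mulD => //; exact: valP a.
Qed.

HB.instance Definition _ n :=
  isIdealr.Build (PolN n) (@QSymPlus_ideal n) (QSymPlus_idealr n).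

Notation QSCoinv n := {ideal_quot (@QSymPlus_ideal n)}.

(* Op maps Pol_n to Pol_m and induces a homomorphism between the quotients. *)
Definition descends (n m : nat) (Op : Pol -> Pol) : Prop :=
  exists phi : {additive QSCoinv n -> QSCoinv m}, forall f : PolN n,
    exists2 g : PolN m, val g = Op (val f) &
      phi (\pi_(QSCoinv n)%qT f) = \pi_(QSCoinv m)%qT g.

(* Main.v *)
From HB Require Import structures.
Require Import Defs.
From mathcomp Require Import all_boot all_order all_algebra.
From mathcomp Require Import finmap boolp monalg zify.

(** The operator T_i is a twisted derivation:
    [T_i (a g) = T_i a * R_(i+1) g + R_i a * T_i g] ([TopM]).
    A quasisymmetric polynomial g in n+1 variables satisfies
    R_0 g = R_1 g = ... = R_n g: the coefficient of m in R_i g is the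
    coefficient in g of the monomial obtained from m by inserting the exponent 0
    at position i ([mcoeff_Rop]), and this insertion changes neither the nonzero
    exponents nor their order. Hence T_i g = 0 for i < n ([QSym_Top]), so
    T_i (a g) = T_i a * R_(i+1) g; since R_(i+1) g is quasisymmetric in n
    variables with the same constant term as g, the operator T_i maps the ideal
    in n+1 variables into the ideal in n variables ([QSymPlus_Top]).

    For a forest F supported on the first n leaves, T_F is a composition of
    operators T_i, one for each internal node. Each of them removes one variable,
    and it remains to check that the index i never reaches the last variable
    still present. Contracting a node of F merges two adjacent leaves and leaves
    a forest supported on one leaf fewer, so this follows by induction, first
    inside one tree ([preserves_tword]) and then over the trees from left to
    right ([preserves_gword]). An additive operator that maps polynomial ring to
    polynomial ring and ideal to ideal induces a map of the quotients
    ([preserves_descends]). *)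

Set Implicit Arguments.
Unset Strict Implicit.
Unset Printing Implicit Defensive.

Import GRing.Theory.
Local Open Scope fset_scope.
Local Open Scope ring_scope.

(** * Renaming the variables of a monomial *)

Lemma cm_big (I : Type) (r : seq I) (P : pred I) (F : I -> {cmonom nat}) k :
  (\big[@mmul _/@mone _]_(s <- r | P s) F s) k = (\sum_(s <- r | P s) F s k)%N.
Proof.
apply: (big_morph (fun m : {cmonom nat} => m k)); last exact: cm1.
by move=> m1 m2; rewrite cmM.
Qed.

Lemma expcmnE (m : {cmonom nat}) e k : expcmn m e k = (e * m k)%N.
Proof.
rewrite /expcmn; case: e => [|e]; first exact: cm1.
elim: e => [|e IH]; first by rewrite mul1n.
rewrite (mulcmE m) mulSn; congr (_ + _)%N; exact: IH.
Qed.

Definition push (h : nat -> nat) (m : {cmonom nat}) : {cmonom nat} :=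
  \big[@mmul _/@mone _]_(j <- finsupp m) expcmn (ucm (h j)) (m j).

(** The hypothesis says that l is the only variable of m that h may send to k, so
    nothing else contributes to the exponent of k. Asking this just of the variables
    of m makes the lemma apply to [unbump i], which is not injective at i. *)
Lemma push_at (h : nat -> nat) (m : {cmonom nat}) k l :
  (forall j, m j != 0%N -> (h j == k) = (j == l)) -> push h m k = m l.
Proof.
move=> H; rewrite /push cm_big.
rewrite (eq_big_seq (fun j => if j == l then m l else 0%N)); last first.
  move=> j; rewrite mem_finsupp expcmnE cmU => /H ->.
  by case: eqP => [->|_]; rewrite ?muln1 ?muln0.
(* The support lists l at most once, and not at all when m l = 0. *)
rewrite -big_mkcond /= big_const_seq iter_addn_0.
case: (boolP (l \in finsupp m)) => h'.
  by rewrite count_uniq_mem ?fset_uniq // h' muln1.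
by rewrite (fsfun_dflt h') mul0n.
Qed.

Lemma push_monom_at h k (idx a : 'I_k -> nat) : injective h ->
  push h (monom_at idx a) = monom_at (fun s => h (idx s)) a.
Proof.
move=> hI; apply/eqP/cmP => l; rewrite [RHS]cm_big.
have E j : monom_at idx a j = (\sum_(s < k) a s * (idx s == j))%N.
  by rewrite [LHS]cm_big; apply: eq_bigr => s _; rewrite expcmnE cmU.
under eq_bigr => s _ do rewrite expcmnE cmU.
case: (boolP [exists s, h (idx s) == l]) => [/existsP[s0 /eqP<-]|/existsPn no].
  rewrite (@push_at _ _ _ (idx s0)) ?E.
    by apply: eq_bigr => s _; rewrite (inj_eq hI).
  by move=> j _; rewrite (inj_eq hI).
rewrite big1 => [|s _]; last by rewrite (negbTE (no s)) muln0.
rewrite /push cm_big big1_seq // => j /andP[_]; rewrite mem_finsupp expcmnE E cmU.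
rewrite sum_nat_eq0 negb_forall => /existsP[s]; rewrite implyTb muln_eq0 => hs.
by move: hs; case: (idx s =P j) => [<-|_]; rewrite ?orbT // (negbTE (no s)) muln0.
Qed.

(** Listing the support in increasing order puts any monomial in the form that the
    definition of quasisymmetry speaks about. *)
Lemma monom_at_exists n (m : {cmonom nat}) :
    (forall k, m k != 0%N -> (k < n)%N) ->
  exists k (idx : 'I_k -> 'I_n) (a : 'I_k -> nat),
    [/\ {homo idx : s t / (s < t)%N}, forall s, (0 < a s)%N & m = monom_at idx a].
Proof.
move=> H; pose A := [pred i : 'I_n | m i != 0%N].
have srt : sorted (relpre val ltn) (enum A).
  rewrite /enum_mem -enumT; apply: sorted_filter; first by move=> x y z; exact: ltn_trans.
  by rewrite -sorted_map val_enum_ord iota_ltn_sorted.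
exists #|A|, (fun s => enum_val s), (fun s => m (enum_val s : 'I_n)); split.
- move=> s t lt; have x0 := enum_val s.
  rewrite !(enum_val_nth x0).
  apply: (sorted_ltn_nth _ x0 srt) lt; rewrite ?inE -?cardE ?ltn_ord //.
  by move=> x y z; exact: ltn_trans.
- by move=> s; rewrite lt0n; exact: (enum_valP s).
apply/eqP/cmP => k; rewrite [RHS]cm_big.
under eq_bigr => s _ do rewrite expcmnE cmU.
rewrite -(big_enum_val (fun i : 'I_n => m i * (val i == k))%N) /=.
case: (eqVneq (m k) 0%N) => [m0|mk].
  by rewrite m0 big1 // => j _; case: eqP => [->|_]; rewrite ?m0 ?muln0.
have lt := H k mk.
rewrite (bigD1 (Ordinal lt)) //= eqxx muln1 big1 ?addn0 // => j /andP[_ nj].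
by case: eqP => [E|_]; rewrite ?muln0 //; move: nj; rewrite -val_eqE /= E eqxx.
Qed.

Lemma bump_inj i : injective (bump i).
Proof. exact: can_inj (bumpK i). Qed.

Lemma ltn_bump i s t : (s < t)%N -> (bump i s < bump i t)%N.
Proof. by rewrite /bump; do 2 case: leqP; lia. Qed.

Lemma push_bump i m k : push (bump i) m (bump i k) = m k.
Proof. by apply: push_at => j _; rewrite (inj_eq (@bump_inj i)). Qed.

Lemma push_bump_self i m : push (bump i) m i = 0%N.
Proof.
rewrite /push cm_big big1_seq // => j _.
by rewrite expcmnE cmU eq_sym (negbTE (neq_bump i j)) muln0.
Qed.

(** * The operators R_i on coefficients *)

Lemma monalgM (m1 m2 : {cmonom nat}) : << mmul m1 m2 >> = << m1 >> * << m2 >> :> Pol.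
Proof.
by rewrite malgM_def fgmulUU (mulr1 (1 : int)).
Qed.

Lemma monalg_exp j e : << expcmn (ucm j) e >> = Xvar j ^+ e :> Pol.
Proof.
elim: e => [|e IH]; first by rewrite expr0.
rewrite exprS -IH [Xvar]unlock -monalgM; congr << _ >>.
by apply/eqP/cmP => k; rewrite cmM !expcmnE mulSn.
Qed.

Lemma monalg_push h m :
  << push h m >> = \prod_(j <- finsupp m) Xvar (h j) ^+ m j :> Pol.
Proof.
rewrite /push (big_morph (fun m : {cmonom nat} => << m >> : Pol) monalgM (erefl _)).
by apply: eq_bigr => j _; rewrite monalg_exp.
Qed.

Lemma Rsub_unbump i j : j != i -> Rsub i j = Xvar (unbump i j).
Proof.
rewrite /Rsub /unbump; case: (ltngtP j i) => // _ _; first by rewrite subn0.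
by rewrite subn1.
Qed.

(** R_i kills the monomials that contain x_i and lowers the larger indices of the
    others by [unbump i]. This is injective on the surviving monomials, with
    inverse [push (bump i)], so each coefficient of R_i f is a single coefficient
    of f. *)
Lemma mcoeff_Rop i f m : (Rop i f)@_m = f@_(push (bump i) m).
Proof.
have term m' : (mon_subst (Rsub i) m')@_m = (m' == push (bump i) m)%:R.
  case: (posnP (m' i)) => [m0|mpos].
    have -> : mon_subst (Rsub i) m' = << push (unbump i) m' >>.
      rewrite monalg_push /mon_subst; apply: eq_big_seq => j.
      rewrite mem_finsupp => mj.
      by rewrite Rsub_unbump //; apply: contraNneq mj => ->; rewrite m0.
    rewrite mcoeffU1; congr (_%:R); congr nat_of_bool.
    have at_ k : push (unbump i) m' k = m' (bump i k).
      apply: push_at => j mj; have ji : j != i by apply: contraNneq mj => ->; rewrite m0.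
      apply/eqP/eqP => [<-|->]; last exact: bumpK.
      by rewrite unbumpK // inE eq_sym.
    apply/eqP/eqP => [<-|E]; apply/eqP/cmP => k; last first.
      by rewrite at_ E push_bump.
    case: (eqVneq k i) => [->|ki]; first by rewrite push_bump_self m0.
    have := unbumpK (h := i) (x := k); rewrite inE => /(_ ki) <-.
    by rewrite push_bump at_.
  case: eqP => [E|_]; first by move: mpos; rewrite E push_bump_self.
  have mi : i \in finsupp m' by rewrite mem_finsupp -lt0n.
  rewrite /mon_subst (big_rem _ mi) /= {1}/Rsub ltnn eqxx expr0n.
  by rewrite eqn0Ngt mpos mul0r mcoeff0.
rewrite /Rop psubstE raddf_sum /=.
under eq_bigr => m' _ do rewrite mcoeffCM term mulr_natr.
case: (boolP (push (bump i) m \in msupp f)) => h; last first.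
  rewrite (mcoeff_outdom h) big1_seq // => m' /andP[_ hm']; case: eqP => // E.
  by move: h; rewrite -E hm'.
rewrite (big_rem _ h) /= eqxx mulr1n big1_seq ?addr0 //.
by move=> m' /andP[_]; rewrite mem_rem_uniq ?fset_uniq // inE => /andP[/negPf-> _].
Qed.

Lemma Rop_in_Pol n i f : (i <= n)%N -> f \in in_Pol n.+1 -> Rop i f \in in_Pol n.
Proof.
move=> le /in_PolP H; apply/in_PolP => m k; rewrite mcoeff_Rop => fm mk.
have := H _ (bump i k) fm; rewrite push_bump => /(_ mk).
by rewrite /bump; case: leqP; lia.
Qed.

Lemma Top_in_Pol n i f : (i < n)%N -> f \in in_Pol n.+1 -> Top i f \in in_Pol n.
Proof.
move=> lt hf; apply/in_PolP => m k; rewrite [Top]unlock mcoeff_divX => fm mk.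
have /in_PolP H : Rop i.+1 f - Rop i f \in in_Pol n.
  by apply: rpredB; apply: Rop_in_Pol => //; apply: ltnW.
by apply: H fm _; rewrite cmM addn_eq0 (negbTE mk) andbF.
Qed.

(** Composing an increasing choice of n indices with [bump i] gives an increasing
    choice among n+1 indices, so equalities between coefficients of g restrict to
    coefficients of R_i g. *)
Lemma QSym_Rop n i g : (i <= n)%N -> QSym n.+1 g -> QSym n (Rop i g).
Proof.
move=> le [gn gq]; split; first exact: Rop_in_Pol.
move=> k a s t a0 hs ht; rewrite !mcoeff_Rop !push_monom_at; try exact: bump_inj.
pose o : 'I_n.+1 := Ordinal (le : (i < n.+1)%N).
apply: (gq k a (fun x => lift o (s x)) (fun x => lift o (t x))) => // x y /= xy.
  by apply: ltn_bump; apply: hs.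
by apply: ltn_bump; apply: ht.
Qed.

Lemma mcoeff1_Rop i f : (Rop i f)@_(@mone _) = f@_(@mone _).
Proof. by rewrite mcoeff_Rop /push mdom1 big_seq_fset0. Qed.

(** For i < n both R_i g and R_(i+1) g are polynomials in n variables whose
    coefficient at a monomial is a coefficient of g at a monomial with the same
    sequence of nonzero exponents; hence they agree. *)
Lemma QSym_Top n i g : (i < n)%N -> QSym n.+1 g -> Top i g = 0.
Proof.
move=> lt gQ; apply: (@X_inj i); rewrite T_spec mulr0; apply/malgP => m.
rewrite mcoeffB mcoeff0; apply/eqP; rewrite subr_eq0; apply/eqP.
have gn := gQ.1.
have /in_PolP H1 := Rop_in_Pol lt gn.
have /in_PolP H0 := Rop_in_Pol (ltnW lt) gn.
case: (boolP (((Rop i.+1 g)@_m != 0) || ((Rop i g)@_m != 0))); last first.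
  by rewrite negb_or !negbK => /andP[/eqP-> /eqP->].
move=> h; have {H0 H1} Hm k : m k != 0%N -> (k < n)%N.
  by case/orP: h => [/H1|/H0]; apply.
have [k [s [a [hs a0 ->]]]] := monom_at_exists Hm.
rewrite !mcoeff_Rop !push_monom_at; try exact: bump_inj.
pose o1 : 'I_n.+1 := Ordinal (lt : (i.+1 < n.+1)%N).
pose o0 : 'I_n.+1 := Ordinal (ltnW lt : (i < n.+1)%N).
apply: (gQ.2 k a (fun x => lift o1 (s x)) (fun x => lift o0 (s x))) => // x y /= xy.
  by apply: ltn_bump; apply: hs.
by apply: ltn_bump; apply: hs.
Qed.

(** * The operators T_i on the quasisymmetric ideal *)

(** The algebra behind the twisted Leibniz rule: divided differences a1 - a0 and
    g1 - g0 by the same x combine like finite differences of a product. *)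
Lemma twisted_quotientM (A : comNzRingType) (x ta tg a1 a0 g1 g0 : A) :
    x * ta = a1 - a0 -> x * tg = g1 - g0 ->
  x * (ta * g1 + a0 * tg) = a1 * g1 - a0 * g0.
Proof.
by move=> Ea Eg; rewrite mulrDr mulrA Ea mulrCA Eg mulrBl mulrBr addrA subrK.
Qed.

Lemma TopM i a g : Top i (a * g) = Top i a * Rop i.+1 g + Rop i a * Top i g.
Proof.
apply: (@X_inj i); rewrite (twisted_quotientM (T_spec i a) (T_spec i g)) T_spec.
have M j : Rop j (a * g) = Rop j a * Rop j g by exact: rmorphM.
by rewrite (M i) (M i.+1).
Qed.

Lemma twisted_quotientB (A : zmodType) (a1 a0 g1 g0 : A) :
  a1 - g1 - (a0 - g0) = (a1 - a0) - (g1 - g0).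
Proof. by rewrite !opprB addrACA [RHS]addrACA; congr (_ + _); rewrite addrC. Qed.

Lemma Top_is_zmod_morphism i : zmod_morphism (Top i).
Proof.
move=> f g; apply: (@X_inj i).
have M j : Rop j (f - g) = Rop j f - Rop j g by exact: rmorphB.
rewrite T_spec (M i) (M i.+1) twisted_quotientB.
by rewrite -(T_spec i f) -(T_spec i g); exact: (esym (mulrBr _ _ _)).
Qed.

HB.instance Definition _ i :=
  GRing.isZmodMorphism.Build Pol Pol (Top i) (Top_is_zmod_morphism i).

(** In the twisted Leibniz rule for a g with g quasisymmetric, the summand
    containing T_i g vanishes. *)
Lemma QSymPlus_Top n i f : (i < n)%N -> QSymPlus n.+1 f -> QSymPlus n (Top i f).
Proof.
move=> lt [s hs ->]; exists [seq (Top i u.1, Rop i.+1 u.2) | u <- s].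
  move=> _ /mapP[u /hs[u1 u2 u0] ->]; split; rewrite /= ?mcoeff1_Rop //.
    exact: Top_in_Pol.
  exact: QSym_Rop.
rewrite big_map raddf_sum; apply: eq_big_seq => u /hs[_ u2 _].
by rewrite /= TopM (QSym_Top lt u2) mulr0 addr0.
Qed.

(** * Descent to the coinvariants *)

Definition preserves n m (Op : Pol -> Pol) : Prop :=
  [/\ zmod_morphism Op,
      forall f, f \in in_Pol n -> Op f \in in_Pol m &
      forall f, QSymPlus n f -> QSymPlus m (Op f)].

Lemma preserves_comp n m p Op1 Op2 :
  preserves m p Op1 -> preserves n m Op2 -> preserves n p (fun f => Op1 (Op2 f)).
Proof.
move=> [z1 p1 q1] [z2 p2 q2]; split=> [f g|f /p2/p1|f /q2/q1] //.
by rewrite z2 z1.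
Qed.

Lemma preserves_Top n i : (i < n)%N -> preserves n.+1 n (Top i).
Proof.
move=> lt; split=> [|f|f]; first exact: raddfB.
- exact: Top_in_Pol.
- exact: QSymPlus_Top.
Qed.

(** The induced map sends a class to the class of the image of its chosen
    representative; since Op respects the ideals, any other representative gives
    the same class, and additivity follows. *)
Lemma preserves_descends n m Op : preserves n m Op -> descends n m Op.
Proof.
move=> [zO pO qO].
pose O (f : PolN n) : PolN m := MkPolN (pO _ (valP f)).
pose phi (x : QSCoinv n) : QSCoinv m := \pi_(QSCoinv m)%qT (O (repr x)).
have OB f g : O (f - g) = O f - O g.
  apply: val_inj; rewrite /= [RHS]/=.
  apply: etrans (zO _ _) _; exact: (esym (raddfB (val : PolN m -> Pol) (O f) (O g))).
have phiE f : phi (\pi_(QSCoinv n)%qT f) = \pi_(QSCoinv m)%qT (O f).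
  apply/eqP; rewrite /phi -Quotient.idealrBE -OB; apply/asboolP; apply: qO.
  have : repr (\pi_(QSCoinv n)%qT f) - f \in @QSymPlus_ideal n.
    by rewrite Quotient.idealrBE reprK.
  by move/asboolP.
have phiB : zmod_morphism phi.
  move=> x y; rewrite -[x]reprK -[y]reprK -raddfB !phiE OB; exact: raddfB.
pose P := GRing.isZmodMorphism.Build _ _ phi phiB.
pose Phi : {additive QSCoinv n -> QSCoinv m} := HB.pack phi P.
by exists Phi => f; exists (O f); rewrite //= phiE.
Qed.

(** * The operators T_F *)

Lemma offsetE F N : offset F N = (N + \sum_(k < N) ninternal (F k))%N.
Proof.
elim: N => [|N IH]; first by rewrite /offset !big_ord0.
by rewrite offsetS IH big_ord_recr /= nleavesE; lia.
Qed.

Lemma fsizeE (F : forest) : fsize F = (\sum_(k < fbound F) ninternal (F k))%N.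
Proof.
rewrite -(big_mkord xpredT (fun k => ninternal (F k))).
rewrite -(@big_rmcond_in _ _ _ _ _ (mem (finsupp F))) => [|k _ /fsfun_dflt-> //].
rewrite -[RHS]big_filter; apply: perm_big; apply: uniq_perm.
- exact: fset_uniq.
- by rewrite filter_uniq // iota_uniq.
move=> k; rewrite mem_filter mem_index_iota /=; case: (boolP (k \in _)) => //= kF.
rewrite ltnNge; apply/esym/negP => /fboundP E.
by move: kF; rewrite mem_finsupp E.
Qed.

(** If the root of t is in position i and the trees before it are already
    contracted, then the leaves of t are in positions i, ..., i + nleaves t - 1.
    Contracting l and then r reduces t to the cherry with leaves i and i+1, both
    still among the remaining variables. For a leaf the operator is the identity,
    wherever the leaf is; this covers the trivial trees of a forest, which may lie
    beyond the first n leaves. *)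
Lemma preserves_tword n i t : (t = Leaf \/ (i + nleaves t <= n)%N) ->
  preserves n (n - ninternal t) (Tword (tword i t)).
Proof.
elim: t i n => [|l IHl r IHr] i n; first by rewrite subn0.
case=> // /=; have El := nleavesE l; have Er := nleavesE r => le.
have Hl : preserves n (n - ninternal l) (Tword (tword i l)) by apply: IHl; right; lia.
have Hr : preserves (n - ninternal l) (n - ninternal l - ninternal r)
  (Tword (tword i.+1 r)) by apply: IHr; right; lia.
have : preserves (n - ninternal l - ninternal r).-1.+1
  (n - ninternal l - ninternal r).-1 (Top i) by apply: preserves_Top; lia.
have -> : (n - (ninternal l + ninternal r).+1 = (n - ninternal l - ninternal r).-1)%N by lia.
rewrite prednK; last by lia.
move=> Ht; have := preserves_comp Ht (preserves_comp Hr Hl).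
by congr preserves; apply/funext => f; rewrite -Tword_cat.
Qed.

(** After the first N trees are contracted, the leaves of the next one have moved
    down by the number of nodes removed, which is also the number of variables
    lost; so its last leaf is still a remaining variable. *)
Lemma preserves_gword n (F : forest) N : For n F ->
  preserves n (n - \sum_(k < N) ninternal (F k)) (Tword (gword F N)).
Proof.
move=> hF; elim: N => [|N IH]; first by rewrite big_ord0 subn0.
rewrite big_ord_recr /= subnDA.
have Ht : preserves (n - \sum_(k < N) ninternal (F k))
    (n - \sum_(k < N) ninternal (F k) - ninternal (F N)) (Tword (tword N (F N))).
  apply: preserves_tword; case: (eqVneq (F N) Leaf) => [|FN]; first by left.
  (* The last leaf of the tree F N belongs to the support of F. *)
  right; have := hF (offset F N.+1).-1; have := offsetS F N; have := offsetE F N.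
  have := nleaves_gt0 (F N) => p0 E1 E2 /(_ _) H.
  have : ((offset F N.+1).-1 < n)%N.
    by apply: H; exists N; split=> //; apply/andP; split; lia.
  lia.
have := preserves_comp Ht IH.
by congr preserves; apply/funext => f; rewrite Tword_cat.
Qed.

Lemma preserves_TF n (F : forest) : For n F -> preserves n (n - fsize F) (TF F).
Proof. by move=> hF; rewrite fsizeE; apply: preserves_gword. Qed.

Theorem corollary9p3 (n : nat) (hn : (0 < n)%N) :
  (forall F : forest, For n F ->
     (forall f : Pol, QSymPlus n f -> QSymPlus (n - fsize F)%N (TF F f)) /\
     descends n (n - fsize F)%N (TF F)) /\
  (forall i, (i < n.-1)%N -> descends n n.-1 (Top i)).
Proof.
split=> [F /preserves_TF hF|i lt].
  by split; [case: hF | exact: preserves_descends].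
by apply: preserves_descends; rewrite -{1}(prednK hn); exact: preserves_Top.
Qed.
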